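(* Let $\mathfrak{h}$ be an even-dimensional real Lie algebra endowed with an ad-invariant metric $(\,,\,)$. The following statements are equivalent: i) $\mathfrak{h}$ admits a generalized complex structure of symplectic type; ii) $\mathfrak{h}$ admits a symplectic structure; iii) $\mathfrak{h}$ admits a non-singular derivation which is skew-symmetric for $(\,,\,)$. Furthermore, if any of these structures exists, then $\mathfrak{h}$ is nilpotent.
   Context: A metric on a Lie algebra is a non-degenerate symmetric bilinear form (of any signature); it is ad-invariant if $([x,y],z)+(y,[x,z])=0$ for all $x,y,z$. A derivation $d$ is skew-symmetric for $(\,,\,)$ if $(dx,y)=-(x,dy)$ for all $x,y$. A symplectic structure on $\mathfrak{h}$ is a non-degenerate 2-form $\omega$ with $\omega([x,y],z)+\omega([y,z],x)+\omega([z,x],y)=0$ for all $x,y,z$. The cotangent Lie algebra $T^*\mathfrak{h}$ is $\mathfrak{h}\oplus\mathfrak{h}^*$ with bracket $[(x,\varphi),(x',\varphi')]=([x,x'],\mathrm{ad}^*(x)\varphi'-\mathrm{ad}^*(x')\varphi)$, $(\mathrm{ad}^*(x)\varphi)(y)=-\varphi([x,y])$; its canonical metric is $\langle(x,\varphi),(x',\varphi')\rangle=\varphi'(x)+\varphi(x')$. A complex structure on a real Lie algebra $\mathfrak{g}$ is a linear map $J$ with $J^2=-\mathrm{I}$ and $[Jx,Jy]-[x,y]-J[Jx,y]-J[x,Jy]=0$ for all $x,y\in\mathfrak{g}$; it is Hermitian for a metric $\langle\,,\,\rangle$ if $\langle Jx,Jy\rangle=\langle x,y\rangle$. A generalized complex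 structure on $\mathfrak{h}$ is a complex structure on $T^*\mathfrak{h}$ which is Hermitian for the canonical metric; it is of symplectic type if $J\mathfrak{h}=\mathfrak{h}^*$. *)

(* Defs.v *)
From HB Require Import structures.
From mathcomp Require Import all_boot all_order all_algebra.
From mathcomp Require Import ring.

Set Implicit Arguments.
Unset Strict Implicit.
Unset Printing Implicit Defensive.

Import GRing.Theory.
Local Open Scope ring_scope.

Reserved Notation "⁅ x , y ⁆" (x at level 200, y at level 200,
  format "⁅ x ,  y ⁆").

HB.mixin Record Lmodule_isLie (K : fieldType) V of GRing.Lmodule K V := {
  lieb : V -> V -> V;
  lieb_linearl : forall y, linear (lieb^~ y);
  lieb_linearr : forall x, linear (lieb x);
  liebxx : forall x, lieb x x = 0;
  lieb_jacobi : forall x y z,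
    lieb x (lieb y z) + lieb y (lieb z x) + lieb z (lieb x y) = 0
}.

(* Finite dimensionality is part of the structure. *)
#[short(type="lieAlgType")]
HB.structure Definition LieAlgebra (K : fieldType) :=
  { V of Vector K V & Lmodule_isLie K V }.

Notation "⁅ x , y ⁆" := (lieb x y) : ring_scope.

HB.instance Definition _ (K : fieldType) (h : lieAlgType K) :=
  bilinear_isBilinear.Build K h h h _ _ (@lieb K h)
    (@lieb_linearl K h, @lieb_linearr K h).

HB.instance Definition _ (K : fieldType) (h : lieAlgType K) (x : h) :=
  GRing.isLinear.Build K h h _ (lieb x) (lieb_linearr x).

Section LieAlgebras.
Variables (K : fieldType) (h : lieAlgType K).
Implicit Types (x y z : h) (U V W : {vspace h}).

Lemma liebC x y : ⁅x, y⁆ = - ⁅y, x⁆.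
Proof.
apply/eqP; rewrite -addr_eq0; apply/eqP.
by have := liebxx (x + y); rewrite linearDl !linearDr /= !liebxx add0r addr0.
Qed.

Lemma lieb_leibniz x y z : ⁅⁅x, y⁆, z⁆ = ⁅x, ⁅y, z⁆⁆ - ⁅y, ⁅x, z⁆⁆.
Proof.
apply/eqP; rewrite -subr_eq0 -oppr_eq0; apply/eqP.
rewrite -(lieb_jacobi x y z) (liebC z x) (liebC z ⁅x, y⁆) linearN /=.
by rewrite opprB.
Qed.

Definition liev U V : {vspace h} :=
  <<[seq ⁅x, y⁆ | x <- vbasis U, y <- vbasis V]>>%VS.

Lemma lievP U V W :
  reflect {in U & V, forall x y, ⁅x, y⁆ \in W} (liev U V <= W)%VS.
Proof.
apply: (iffP span_subvP) => [sW x y xU yV | sW u].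
  rewrite (coord_vbasis xU) (coord_vbasis yV) linear_sumlz.
  apply: memv_suml => i _; rewrite linearZl_LR memvZ // linear_sumr.
  apply: memv_suml => j _; rewrite linearZr_LR memvZ // sW //.
  by apply/allpairsP; exists ((vbasis U)`_i, (vbasis V)`_j); rewrite !memt_nth.
by case/allpairsP=> -[x y] /= [/vbasis_mem xU /vbasis_mem yV ->]; apply: sW.
Qed.

Fixpoint lower_central (n : nat) : {vspace h} :=
  if n is m.+1 then liev fullv (lower_central m) else fullv.

Definition lie_nilpotent := exists n, lower_central n = 0%VS.

Definition derivation (d : 'End(h)) :=
  forall x y, d ⁅x, y⁆ = ⁅d x, y⁆ + ⁅x, d y⁆.

Definition nonsingular (d : 'End(h)) := lker d == 0%VS.

Definition complex_structure (J : 'End(h)) :=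
  (forall x, J (J x) = - x) /\
  (forall x y, ⁅J x, J y⁆ - ⁅x, y⁆ - J ⁅J x, y⁆ - J ⁅x, J y⁆ = 0).

Definition skew_for (B : h -> h -> K) (d : 'End(h)) :=
  forall x y, B (d x) y = - B x (d y).

Definition hermitian_for (B : h -> h -> K) (J : 'End(h)) :=
  forall x y, B (J x) (J y) = B x y.

Definition ad_invariant (B : h -> h -> K) :=
  forall x y z, B ⁅x, y⁆ z + B y ⁅x, z⁆ = 0.

Definition closed_form (w : h -> h -> K) :=
  forall x y z, w ⁅x, y⁆ z + w ⁅y, z⁆ x + w ⁅z, x⁆ y = 0.

End LieAlgebras.

Arguments lie_nilpotent {K} h.

(* In characteristic different from 2, {symmetric h} and {skew_symmetric h}
   are the symmetric bilinear forms and the 2-forms (alternating forms). *)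
Definition metric (K : fieldType) (h : lieAlgType K) (B : {symmetric h}) :=
  nondegenerate B.

Definition symplectic_structure (K : fieldType) (h : lieAlgType K)
    (w : {skew_symmetric h}) :=
  nondegenerate w /\ closed_form w.

Definition cotangent (K : fieldType) (h : lieAlgType K) : Type :=
  (h * 'Hom(h, K^o))%type.

Section Cotangent.
Variables (K : fieldType) (h : lieAlgType K).
Local Notation "'T*h'" := (cotangent h).
Implicit Types (x y z : h) (f g : 'Hom(h, K^o)) (u v w : T*h).

HB.instance Definition _ := Vector.copy T*h (h * 'Hom(h, K^o))%type.

Definition coad x f : 'Hom(h, K^o) := - (f \o linfun (lieb x))%VF.

Lemma coadE x f y : coad x f y = - f ⁅x, y⁆.
Proof. by rewrite opp_lfunE comp_lfunE lfunE. Qed.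

Definition cot_bracket u v : T*h :=
  (⁅u.1, v.1⁆, coad u.1 v.2 - coad v.1 u.2).

Fact cot_bracketxx u : cot_bracket u u = 0.
Proof. by rewrite /cot_bracket liebxx subrr. Qed.

Fact cot_bracket_linearl v : linear (cot_bracket^~ v).
Proof.
move=> a u1 u2; rewrite /cot_bracket; congr pair => /=.
  by rewrite linearPl.
apply/lfunP => y; rewrite !(coadE, add_lfunE, opp_lfunE, scale_lfunE).
rewrite linearPl linearP /= scalerBr !scalerN !opprK !opprD.
by rewrite addrACA.
Qed.

Fact cot_bracket_linearr u : linear (cot_bracket u).
Proof.
have cC v w : cot_bracket v w = - cot_bracket w v.
  by rewrite /cot_bracket liebC -opprB.
by move=> a v w; rewrite cC cot_bracket_linearl opprD -scalerN -!cC.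
Qed.

Fact cot_bracket_jacobi u v w :
  cot_bracket u (cot_bracket v w) + cot_bracket v (cot_bracket w u) +
  cot_bracket w (cot_bracket u v) = 0.
Proof.
rewrite /cot_bracket; congr pair => /=; first exact: lieb_jacobi.
apply/lfunP => y; rewrite !(coadE, add_lfunE, opp_lfunE, zero_lfunE).
rewrite !lieb_leibniz !linearB /=.
pose t f x y z : K := f ⁅x, ⁅y, z⁆⁆; rewrite -![_ ⁅_, ⁅_, _⁆⁆]/(t _ _ _ _).
by ring.
Qed.

HB.instance Definition _ := Lmodule_isLie.Build K T*h
  cot_bracket_linearl cot_bracket_linearr cot_bracketxx cot_bracket_jacobi.

Lemma cot_bracketE u v : ⁅u, v⁆ = (⁅u.1, v.1⁆, coad u.1 v.2 - coad v.1 u.2).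
Proof. by []. Qed.

Definition cot_metric u v : K := v.2 u.1 + u.2 v.1.

Definition cot_inl x : T*h := (x, 0).
Definition cot_inr f : T*h := (0, f).

Fact cot_inl_linear : linear cot_inl.
Proof. by move=> a x y; congr pair; rewrite /= scaler0 addr0. Qed.

Fact cot_inr_linear : linear cot_inr.
Proof. by move=> a f g; congr pair; rewrite /= scaler0 addr0. Qed.

HB.instance Definition _ :=
  GRing.isLinear.Build K h T*h _ cot_inl cot_inl_linear.
HB.instance Definition _ :=
  GRing.isLinear.Build K 'Hom(h, K^o) T*h _ cot_inr cot_inr_linear.

(* The subspaces h and h^* of T*h. *)
Definition cot_base : {vspace T*h} := limg (linfun cot_inl).
Definition cot_fiber : {vspace T*h} := limg (linfun cot_inr).

Lemma cot_baseP u : reflect (u.2 = 0) (u \in cot_base).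
Proof.
apply: (iffP memv_imgP) => [[x _ ->]|]; first by rewrite lfunE.
by case: u => x f /= ->; exists x; rewrite ?memvf ?lfunE.
Qed.

Lemma cot_fiberP u : reflect (u.1 = 0) (u \in cot_fiber).
Proof.
apply: (iffP memv_imgP) => [[x _ ->]|]; first by rewrite lfunE.
by case: u => x f /= ->; exists f; rewrite ?memvf ?lfunE.
Qed.

Definition generalized_complex_structure (J : 'End(T*h)) :=
  complex_structure J /\ hermitian_for cot_metric J.

Definition symplectic_type (J : 'End(T*h)) := (J @: cot_base = cot_fiber)%VS.

End Cotangent.

(* Main.v *)
(* A non-degenerate 2-form w amounts to an isomorphism A : h -> h^*, given by
   A x = w(x, -), and the generalized complex structures of symplectic type are
   exactly the maps (x, f) |-> (- A^-1 f, A x), integrability being the closedness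
   of w.  Writing w(x, y) = B(d x, y), closedness becomes the Leibniz rule for d.

   Nilpotency holds as soon as there is a non-singular derivation d (Jacobson).
   Over the complex numbers, ad h is spanned by generalized eigenvectors of
   [d, -], with nonzero eigenvalues.  They are closed under brackets, and each is
   nilpotent: the powers of a generalized eigenvector of eigenvalue c have
   eigenvalues 2c, 3c, ..., only finitely many of which can occur.  Jacobson's
   version of Engel's theorem, for bracket-closed sets of nilpotent elements, then
   shows that ad h generates a nilpotent associative algebra. *)

Require Import Defs.
From HB Require Import structures.
From mathcomp Require Import all_boot all_order all_algebra all_field.
From mathcomp Require Import boolp reals ring complex.

Set Implicit Arguments.
Unset Strict Implicit.
Unset Printing Implicit Defensive.

Import GRing.Theory Num.Theory FalgLfun.
Local Open Scope ring_scope.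

(** * Bracket-closed sets of nilpotent elements *)

Section EngelJacobson.
Variables (F : fieldType) (A : falgType F).
Implicit Types (U V : {vspace A}) (s u : A).

Definition adl s u := s * u - u * s.

Fact adl_linearl u : linear (adl^~ u).
Proof.
move=> a s v; rewrite /adl mulrDl mulrDr -scalerAl -scalerAr scalerBr opprD.
exact: addrACA.
Qed.

Fact adl_linearr s : linear (adl s).
Proof.
move=> a u v; rewrite /adl mulrDl mulrDr -scalerAl -scalerAr scalerBr opprD.
exact: addrACA.
Qed.

HB.instance Definition _ := bilinear_isBilinear.Build F A A A _ _ adl
  (adl_linearl, adl_linearr).

HB.instance Definition _ s :=
  GRing.isLinear.Build F A A _ (adl s) (adl_linearr s).

Lemma adlxx u : adl u u = 0. Proof. exact: subrr. Qed.

Lemma adlC s u : adl s u = - adl u s. Proof. by rewrite opprB. Qed.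

Lemma expv_eq0_le U n m : (n <= m)%N -> (U ^+ n = 0)%VS -> (U ^+ m = 0)%VS.
Proof. by move=> /subnK <- Un0; rewrite expvD Un0 prodv0. Qed.

(* The powers U^k A form a filtration stable under left multiplication by s and
   by U, and U kills its graded pieces, so that a word of length m in U + <s>
   acts on a graded piece either as 0 or as s^m. *)
Lemma nilpotent_addv_line U s n m :
    {in U, forall u, adl s u \in U} -> (U ^+ n = 0)%VS -> s ^+ m = 0 ->
  ((U + <[s]>) ^+ (m * n) = 0)%VS.
Proof.
move=> sU Un0 sm0; pose I k := (U ^+ k * fullv)%VS.
have UI k : (U * I k = I k.+1)%VS by rewrite /I expvSl prodvA.
have IS k : (I k.+1 <= I k)%VS by rewrite /I expvSr -prodvA prodvSr ?subvf.
have sUS : (<[s]> * U <= U * <[s]> + U)%VS.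
  apply/prodvP => _ u /vlineP[a ->] uU.
  rewrite -scalerAl memvZ // -[s * u](subrK (u * s)) addrC.
  by rewrite memv_add ?memv_mul ?memv_line // sU.
have sUk k : (<[s]> * U ^+ k <= U ^+ k * <[s]> + U ^+ k)%VS.
  elim: k => [|k IHk]; first by rewrite prodv1 prod1v addvSl.
  rewrite expvSl prodvA (subv_trans (prodvSl _ sUS)) // prodvDl -!prodvA.
  rewrite subv_add addvSr andbT -prodvDr; exact: prodvSr.
have sI k : (<[s]> * I k <= I k)%VS.
  rewrite /I prodvA (subv_trans (prodvSl _ (sUk k))) // prodvDl subv_add.
  by rewrite subvv andbT -prodvA prodvSr ?subvf.
have sjI j k : (<[s ^+ j]> * I k <= I k)%VS.
  elim: j => [|j IHj]; first by rewrite expr0 prod1v.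
  by rewrite exprS -prodv_line -prodvA (subv_trans _ (sI k)) ?prodvSr.
have VI j k : ((U + <[s]>) ^+ j * I k <= <[s ^+ j]> * I k + I k.+1)%VS.
  elim: j => [|j IHj]; first by rewrite expv0 expr0 addvSl.
  rewrite expvSl -prodvA (subv_trans (prodvSr _ IHj)) // prodvDl !prodvDr.
  rewrite !subv_add; apply/andP; split; apply/andP; split.
  - by rewrite (subv_trans _ (addvSr _ _)) // -UI prodvSr.
  - by rewrite (subv_trans _ (addvSr _ _)) // UI IS.
  - by rewrite prodvA prodv_line -exprS addvSl.
  - by rewrite (subv_trans _ (addvSr _ _)) ?sI.
have VIk k : ((U + <[s]>) ^+ (m * k) * fullv <= I k)%VS.
  elim: k => [|k IHk]; first by rewrite muln0.
  rewrite mulnS expvD -prodvA (subv_trans (prodvSr _ IHk)) //.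
  by rewrite (subv_trans (VI m k)) // sm0 prod0v add0v.
apply/eqP; rewrite -subv0 -(prod0v fullv) -Un0 (subv_trans _ (VIk n)) //.
by rewrite -[X in (X <= _)%VS]prodv1 prodvSr ?subvf.
Qed.

Section WeaklyClosed.
Variable S : A -> Prop.
Hypothesis S_comm : forall s u, S s -> S u -> S (adl s u).
Hypothesis S_nil : forall s, S s -> exists m, s ^+ m = 0.

(* If no element of S outside U normalizes U, brackets with generators of U
   never lead from S \ U into U; but an iterated bracket of length 2n is a sum
   of products with at least n factors in U on one side, hence 0. *)
Lemma exists_normalizing U (X : seq A) n s0 :
    (forall x, x \in X -> S x) -> U = <<X>>%VS -> (U ^+ n = 0)%VS ->
    S s0 -> s0 \notin U ->
  exists s, [/\ S s, s \notin U & {in U, forall u, adl s u \in U}].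
Proof.
move=> XS UX Un0 Ss0 s0U; apply: contrapT => noS.
(* [W k] contains the k-fold brackets of any element with U: i factors of U stand on its left and k
   - i on its right, with [fullv] leaving room for the element itself. *)
pose W k : {vspace A} := (\sum_(i < k.+1) U ^+ i * (fullv * U ^+ (k - i)))%VS.
have WU k s u : s \in W k -> u \in U -> s * u \in W k.+1.
  case/memv_sumP=> t tW -> uU; rewrite mulr_suml; apply: memv_suml => i _.
  apply: (subvP (sumv_sup (widen_ord (leqnSn _) i) isT (subvv _))) => /=.
  rewrite subSn -1?ltnS // expvSr !prodvA memv_mul // -prodvA; exact: tW.
have UW k s u : s \in W k -> u \in U -> u * s \in W k.+1.
  case/memv_sumP=> t tW -> uU; rewrite mulr_sumr; apply: memv_suml => i _.
  apply: (subvP (sumv_sup (lift ord0 i) isT (subvv _))).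
  rewrite lift0 subSS expvSl -!prodvA memv_mul //; exact: tW.
have: exists s, [/\ S s, s \notin U & s \in W (n + n)%N].
  elim: (n + n)%N => [|k [s [Ss sU sW]]].
    exists s0; split=> //; rewrite /W big_ord1 expv0 prod1v prodv1.
    exact: memvf.
  have [x xX sxU] : exists2 x, x \in X & adl s x \notin U.
    apply: contrapT => noX; apply: noS; exists s; split=> //.
    suff /subvP sXU : (U <= linfun (adl s) @^-1: U)%VS.
      by move=> u uU; have := sXU u uU; rewrite -memv_preim lfunE.
    rewrite {1}UX; apply/span_subvP => x xX; rewrite -memv_preim lfunE.
    by apply: contrapT => /negP sxU; apply: noX; exists x.
  have xU : x \in U by rewrite UX memv_span.
  exists (adl s x); split=> //.
    by apply: S_comm => //; apply: XS.
  by apply: memvB; [apply: WU | apply: UW].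
case=> s [_ sU]; rewrite (_ : W _ = 0%VS).
  by rewrite memv0 => /eqP s0E; rewrite s0E mem0v in sU.
apply: big1 => i _; have [/(expv_eq0_le)->//|lt_in] := leqP n i.
  by rewrite prod0v.
rewrite (@expv_eq0_le U n (n + n - i)) ?prodv0 //.
by rewrite -addnBA ?leq_addr // ltnW.
Qed.

(** A list of elements of S with nilpotent, bracket-closed span is enlarged by a normalizing element
    of S until its span contains S. Each enlargement lowers the codimension, on which the induction
    runs. *)
Theorem engel_jacobson :
  exists U n, (forall s, S s -> s \in U) /\ (U ^+ n = 0)%VS.
Proof.
suff IH d : forall (X : seq A) n, (forall x, x \in X -> S x) ->
    {in <<X>>%VS &, forall u v, adl u v \in <<X>>%VS} ->
    (<<X>> ^+ n = 0)%VS -> (\dim {:A} - \dim <<X>> <= d)%N ->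
  exists U n, (forall s, S s -> s \in U) /\ (U ^+ n = 0)%VS.
  apply: (IH _ [::] 1%N) (leqnn _) => //; rewrite span_nil ?expv1 //.
  by move=> u v; rewrite !memv0 => /eqP-> _; rewrite linear0l.
elim: d => [|d IHd] X n XS XX Xn0 dX.
  exists <<X>>%VS, n; split=> // s _; rewrite (_ : <<X>>%VS = fullv) ?memvf //.
  by apply/eqP; rewrite eqEdim subvf -subn_eq0 -leqn0.
have [?|/existsNP[s0 /not_implyP[Ss0 /negP s0U]]] :=
  pselect (forall s, S s -> s \in <<X>>%VS); first by exists <<X>>%VS, n.
have [s [Ss sU sX]] := exists_normalizing XS erefl Xn0 Ss0 s0U.
have [m sm0] := S_nil Ss.
have eX : (<<s :: X>> = <<X>> + <[s]>)%VS by rewrite span_cons addvC.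
apply: (IHd (s :: X) (m * n)%N).
- by move=> x; rewrite inE => /predU1P[->|/XS].
- rewrite eX => w z /memv_addP[u uX [_ /vlineP[a ->] ->]].
  case/memv_addP=> v vX [_ /vlineP[b ->] ->].
  apply: (subvP (addvSl _ _)).
  rewrite linearDl !linearDr /= !linearZr_LR /= !linearZl_LR /= adlxx.
  rewrite !scaler0 addr0 [adl u s]adlC scalerN.
  apply: memvD; last by rewrite memvZ ?sX.
  by apply: memvB; [apply: XX | rewrite memvZ ?sX].
- by rewrite eX nilpotent_addv_line.
have ltX V w : (<<X>> <= V)%VS -> w \in V -> w \notin <<X>>%VS ->
    (\dim <<X>> < \dim V)%N.
  move=> sXV wV; apply: contraR; rewrite -leqNgt => le_VX.
  by rewrite (eqP (_ : <<X>> == V)%VS) ?eqEdim ?sXV.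
rewrite -ltnS (leq_trans _ dX) // ltn_sub2l //.
  by apply: ltX s0U; rewrite ?subvf ?memvf.
by apply: ltX sU; rewrite eX ?addvSl // (subvP (addvSr _ _)) ?memv_line.
Qed.

End WeaklyClosed.
End EngelJacobson.

(** * Generalized eigenvectors *)

Lemma horner_algZ (F : fieldType) (E : falgType F) (a : E) c (p : {poly F}) :
  horner_alg a (c *: p) = c *: horner_alg a p.
Proof. by rewrite -mul_polyC rmorphM /= horner_algC mulr_algl. Qed.

(** Polynomials of degree at most N = dim E form a space of dimension N + 1, so evaluation at a has
    a nonzero kernel. *)
Lemma falg_annihilator (F : fieldType) (E : falgType F) (a : E) :
  exists2 p : {poly F}, p != 0 & horner_alg a p = 0.
Proof.
pose N := \dim {:E}; pose h (r : 'rV[F]_N.+1) := horner_alg a (rVpoly r).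
have h_linear : linear h.
  by move=> c r1 r2; rewrite /h linearP rmorphD /= horner_algZ.
pose hL := GRing.isLinear.Build F _ E _ h h_linear.
pose g := linfun (HB.pack h hL : {linear 'rV[F]_N.+1 -> E}).
have gE r : g r = horner_alg a (rVpoly r) by rewrite lfunE.
have kerg : lker g != 0%VS.
  have := limg_ker_dim g fullv; rewrite capfv [in RHS]dimvf /dim /= mul1n.
  apply: contra_eqN => /eqP->; rewrite dimv0 add0n ltn_eqF // ltnS.
  exact: dimvS (subvf _).
exists (rVpoly (vpick (lker g))).
  apply: contra_neq kerg => r0; apply/eqP; rewrite -vpick0.
  by rewrite -[vpick _]rVpolyK r0 linear0.
by apply/eqP; rewrite -gE -memv_ker memv_pick.
Qed.

Section GeneralizedEigenvectors.
Variables (F : closedFieldType) (A : falgType F) (f : 'End(A)).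
Implicit Types (L U : {vspace A}) (v w : A) (c : F).

Definition shift c : 'End(A) := f - c%:A.

Definition geigenvector c v := exists k, (shift c ^+ k) v = 0.

Lemma shiftE c v : shift c v = f v - c *: v.
Proof. by rewrite /shift !(add_lfunE, opp_lfunE, scale_lfunE, id_lfunE). Qed.

Lemma shift_expS c k v : (shift c ^+ k.+1) v = (shift c ^+ k) (shift c v).
Proof. by rewrite exprS lfun_mulE. Qed.

Lemma shift_exp_le c i j v :
  (i <= j)%N -> (shift c ^+ i) v = 0 -> (shift c ^+ j) v = 0.
Proof. by move=> /subnKC <- v0; rewrite exprD lfun_mulE v0 linear0. Qed.

Lemma geigenvector0 c : geigenvector c 0.
Proof. by exists 0%N; rewrite linear0. Qed.

Lemma geigenvectorD c v w :
  geigenvector c v -> geigenvector c w -> geigenvector c (v + w).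
Proof.
move=> [i vi] [j wj]; exists (i + j)%N; rewrite linearD /=.
rewrite (shift_exp_le (leq_addr _ _) vi) (shift_exp_le (leq_addl _ _) wj).
exact: addr0.
Qed.

Lemma geigenvectorN c v : geigenvector c v -> geigenvector c (- v).
Proof. by move=> [k vk]; exists k; rewrite linearN /= vk oppr0. Qed.

Section Stable.
Variable L : {vspace A}.
Hypothesis fL : {in L, forall v, f v \in L}.

Lemma shift_stable c : {in L, forall v, shift c v \in L}.
Proof. by move=> v vL; rewrite shiftE memvB ?memvZ ?fL. Qed.

(** If [shift c' z = shift c v], then (v - z) / (c - c') is a preimage of v, because
    [shift c' v - shift c v] is (c - c') v. *)
Lemma shift_preim c c' v : c != c' -> v \in L -> geigenvector c v ->
  exists z, [/\ z \in L, geigenvector c z & shift c' z = v].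
Proof.
move=> cc' vL [k]; elim: k v vL => [|k IHk] v vL.
  rewrite id_lfunE => ->; exists 0.
  by rewrite mem0v linear0; split=> //; apply: geigenvector0.
move=> vk; move: (vk); rewrite shift_expS.
move=> /(IHk _ (shift_stable c vL))[z [zL [j zj] fz]].
have d0 : c - c' != 0 by rewrite subr_eq0.
exists ((c - c')^-1 *: (v - z)); split.
- by rewrite memvZ // memvB.
- exists (j + k.+1)%N; rewrite linearZ linearB /=.
  rewrite (shift_exp_le (leq_addr _ _) zj) (shift_exp_le (leq_addl _ _) vk).
  by rewrite subrr scaler0.
rewrite linearZ linearB /= fz !shiftE opprB [X in _ *: X]addrC addrA subrK.
by rewrite -scalerBl scalerA mulVf // scale1r.
Qed.

Inductive gsum : A -> Prop :=
  | gsum0 : gsum 0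
  | gsumD c v w : v \in L -> geigenvector c v -> gsum w -> gsum (v + w).

(* On generalized eigenvectors of eigenvalue c' != c, [shift c] can be inverted;
   what remains is a generalized eigenvector of eigenvalue c. *)
Lemma gsum_shift c v : v \in L -> gsum (shift c v) -> gsum v.
Proof.
(* The accumulator w collects the summands of eigenvalue c; each of the others is removed by
   subtracting a preimage of it from y. *)
suff gsumP x : gsum x -> forall w y, w \in L -> geigenvector c w -> y \in L ->
    shift c y = w + x -> gsum y.
  move=> vL /gsumP/(_ 0 v (mem0v _) (geigenvector0 _) vL); apply.
  by rewrite add0r.
elim=> [|c' u x' uL cu gx' IH] w y wL cw yL.
  rewrite addr0 => yw; rewrite -[y]addr0; apply: (gsumD (c := c)) yL _ gsum0.
  by case: cw => k wk; exists k.+1; rewrite shift_expS yw.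
have [cc'|cc'] := eqVneq c' c.
  rewrite addrA; apply: IH => //; first exact: memvD.
  by apply: geigenvectorD => //; rewrite -cc'.
move=> yE; have [z [zL c'z fz]] := shift_preim cc' uL cu.
rewrite -[y](subrKC z); apply: (gsumD zL c'z).
apply: (IH w) => //; first exact: memvB.
by rewrite linearB /= fz yE addrCA [u + _]addrC addrK.
Qed.

(** An annihilating polynomial of f splits into linear factors, so a product of shifts kills every x
    in L; [gsum_shift] removes these shifts one at a time. *)
Lemma geigenvector_span U :
  (forall c v, v \in L -> geigenvector c v -> v \in U) -> (L <= U)%VS.
Proof.
move=> LU; have gU x : gsum x -> x \in U.
  by elim=> [|c v w vL cv _ wU]; rewrite ?mem0v // memvD // (LU c).
apply/subvP => x xL; apply: gU; have [p p0 fp] := falg_annihilator f.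
have [rs pE] := closed_field_poly_normal p.
have: horner_alg f (\prod_(z <- rs) ('X - z%:P)) x = 0.
  have /eqP := congr1 (fun g : 'End(A) => g x) fp; rewrite pE horner_algZ.
  rewrite scale_lfunE zero_lfunE scaler_eq0 lead_coef_eq0 (negPf p0) /=.
  by move/eqP.
elim: rs x xL {pE} => [|z rs IHrs] x xL.
  by rewrite big_nil rmorph1 id_lfunE => ->; apply: gsum0.
rewrite big_cons rmorphM lfun_mulE rmorphB /= horner_algX horner_algC.
by move/(IHrs _ (shift_stable z xL)); apply: gsum_shift.
Qed.

End Stable.

(** The last nonzero vector among v, [shift c v], ... is an eigenvector, on which p(f) = 0 acts as
    the scalar p(c). *)
Lemma geigenvalue_root (p : {poly F}) c v :
  horner_alg f p = 0 -> v != 0 -> geigenvector c v -> root p c.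
Proof.
move=> fp v0 [k]; elim: k v v0 => [|k IHk] v v0.
  by rewrite id_lfunE => vE; rewrite vE eqxx in v0.
rewrite shift_expS; have [cv _|cv /IHk] := eqVneq (shift c v) 0; last exact.
have /factor_theorem[q pE] : root (p - p.[c]%:P) c.
  by rewrite rootE !hornerE subrr.
have /eqP := congr1 (fun g : 'End(A) => g v) fp.
rewrite -[X in horner_alg f X](subrK p.[c]%:P) pE mulrC rmorphD rmorphM.
rewrite rmorphB /= horner_algX !horner_algC add_lfunE lfun_mulE cv linear0 add0r.
by rewrite scale_lfunE id_lfunE zero_lfunE scaler_eq0 (negPf v0) orbF.
Qed.

End GeneralizedEigenvectors.

(** * Generalized eigenvectors of derivations of an associative algebra *)

Section Derivations.
Variables (F : closedFieldType) (A : falgType F) (f : 'End(A)).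
Hypothesis charF : [pchar F] =i pred0.
Hypothesis f_der : forall x y, f (x * y) = f x * y + x * f y.
Implicit Types (x y : A) (c : F).

(** The shift by c + c' satisfies a Leibniz rule with the shift by c on x and by c' on y, so each
    application lowers one of the two exponents. *)
Lemma geigenvectorM c c' x y :
  geigenvector f c x -> geigenvector f c' y -> geigenvector f (c + c') (x * y).
Proof.
move=> [i xi] [j yj]; exists (i + j)%N.
have [n] := ubnP (i + j)%N; elim: n i j x y xi yj => // n IHn.
move=> i j x y xi yj.
have fxy : shift f (c + c') (x * y) = shift f c x * y + x * shift f c' y.
  rewrite !shiftE f_der mulrBl mulrBr -scalerAl -scalerAr scalerDl opprD.
  exact: addrACA.
case: i xi => [|i] xi.
  by move: xi; rewrite id_lfunE => ->; rewrite mul0r linear0.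
case: j yj => [|j] yj.
  by move: yj; rewrite id_lfunE => ->; rewrite mulr0 linear0.
move=> ltijn; rewrite addSn shift_expS fxy linearD /= -[RHS]addr0.
congr (_ + _); first by apply: IHn => //; rewrite -shift_expS.
by rewrite addnS -addSn; apply: IHn; rewrite -?shift_expS // addSn -addnS.
Qed.

Lemma geigenvectorX c x k : f 1 = 0 ->
  geigenvector f c x -> geigenvector f (c *+ k) (x ^+ k).
Proof.
move=> f1 cx; elim: k => [|k IHk].
  by exists 1%N; rewrite expr1 expr0 shiftE f1 scale0r subr0.
by rewrite mulrS exprS; apply: geigenvectorM.
Qed.

(* Otherwise all the multiples of c would be eigenvalues of f. *)
Lemma geigenvector_nilpotent c x :
  f 1 = 0 -> c != 0 -> geigenvector f c x -> exists k, x ^+ k = 0.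
Proof.
move=> f1 c0 cx; apply: contrapT => xk.
have [p p0 fp] := falg_annihilator f.
have rp k : root p (c *+ k).
  apply: (geigenvalue_root fp) (geigenvectorX k f1 cx).
  by apply/eqP => xk0; apply: xk; exists k.
(* As [size p] exceeds the degree of p, these multiples, distinct in characteristic 0, are too many
   roots. *)
pose rs := [seq c *+ k | k <- iota 0 (size p)].
have rootrs : all (root p) rs by apply/allP => _ /mapP[k _ ->].
suff /(max_poly_roots p0 rootrs) : uniq rs by rewrite size_map size_iota ltnn.
rewrite map_inj_uniq ?iota_uniq // => i j; wlog le_ij : i j / (i <= j)%N.
  by move=> IH; case/orP: (leq_total i j) => [/IH//|/IH ji /esym/ji].
move/esym/eqP; rewrite -subr_eq0 -mulrnBr // -mulr_natl mulf_eq0 (negPf c0).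
rewrite orbF ((pcharf0P _).1 charF) subn_eq0 => le_ji.
by apply/eqP; rewrite eqn_leq le_ij.
Qed.

End Derivations.

(** [engel_jacobson] applies to the generalized eigenvectors of [adl D] in L: injectivity leaves
    only 0 at eigenvalue 0, so all are nilpotent, and they span L. *)
Theorem nilpotent_of_injective_adl (F : closedFieldType) (A : falgType F)
    (D : A) (L : {vspace A}) :
    [pchar F] =i pred0 -> {in L &, forall x y, adl x y \in L} ->
    {in L, forall x, adl D x \in L} -> {in L, forall x, adl D x = 0 -> x = 0} ->
  exists n, (L ^+ n = 0)%VS.
Proof.
move=> charF LL DL D_inj; pose f : 'End(A) := linfun (adl D).
have fE x : f x = adl D x by rewrite lfunE.
have f_der x y : f (x * y) = f x * y + x * f y.
  by rewrite !fE /adl mulrBl mulrBr !mulrA addrA subrK.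
have f1 : f 1 = 0 by rewrite fE /adl mulr1 mul1r subrr.
have fL : {in L, forall x, f x \in L} by move=> x xL; rewrite fE DL.
have f0 k x : x \in L -> (shift f 0 ^+ k) x = 0 -> x = 0.
  elim: k x => [|k IHk] x xL; first by rewrite id_lfunE.
  rewrite shift_expS => /(IHk _ (shift_stable fL 0 xL)).
  by rewrite shiftE scale0r subr0 fE => /(D_inj _ xL).
pose S x := x \in L /\ exists c, geigenvector f c x.
have [x y [xL [c cx]] [yL [c' c'y]]|x [xL [c cx]]|U [n [SU Un0]]] :=
    @engel_jacobson F A S.
- split; first exact: LL.
  exists (c + c'); apply: geigenvectorD; first exact: geigenvectorM.
  by apply: geigenvectorN; rewrite addrC; apply: geigenvectorM.
- have [c0|c0] := eqVneq c 0.
    by case: cx => k; rewrite c0 => /(f0 _ _ xL) ->; exists 1%N.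
  exact: (geigenvector_nilpotent charF f_der f1 c0 cx).
have LU : (L <= U)%VS.
  apply: (geigenvector_span fL) => c x xL cx; apply: SU.
  by split=> //; exists c.
by exists n; apply/eqP; rewrite -subv0 -Un0 expvS.
Qed.

(** * Nonsingular derivations *)

Section NonsingularDerivation.
Import passmx.
Variables (K : fieldType) (C : closedFieldType) (iota : {rmorphism K -> C}).
Hypothesis charC : [pchar C] =i pred0.
Variable h : lieAlgType K.
Implicit Types (x y z : h) (f g : 'End(h)).

Local Notation n := (\dim {:h}).
Local Notation b := (vbasis {:h}).

Definition ad x : 'End(h) := linfun (lieb x).

Lemma adE x y : ad x y = ⁅x, y⁆. Proof. exact: lfunE. Qed.

Lemma ad_lieb x y : ad ⁅x, y⁆ = ((ad x \o ad y) - (ad y \o ad x))%VF.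
Proof.
by apply/lfunP => z; rewrite add_lfunE opp_lfunE !comp_lfunE !adE lieb_leibniz.
Qed.

Lemma ad_derivation d x :
  derivation d -> ad (d x) = ((d \o ad x) - (ad x \o d))%VF.
Proof.
move=> d_der; apply/lfunP => y.
by rewrite add_lfunE opp_lfunE !comp_lfunE !adE d_der addrK.
Qed.

(* Matrices act on the right of row vectors, whence an anti-morphism; the zero
   block of size 1 makes the size nonzero, so that matrices form an algebra. *)
Definition mx_ext f : 'M[C]_n.+1 :=
  block_mx (0 : 'M_1) 0 0 (map_mx iota (mxof b b f)).

Lemma mx_extD f g : mx_ext (f + g) = mx_ext f + mx_ext g.
Proof.
have := add_block_mx (0 : 'M[C]_1) 0 0 (map_mx iota (mxof b b f))
  0 0 0 (map_mx iota (mxof b b g)).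
by rewrite !addr0 -map_mxD -linearD => ->.
Qed.

Lemma mx_extZ a f : mx_ext (a *: f) = iota a *: mx_ext f.
Proof.
have := scale_block_mx (iota a) (0 : 'M[C]_1) 0 0 (map_mx iota (mxof b b f)).
by rewrite !scaler0 -map_mxZ -linearZ => ->.
Qed.

Fact mx_ext_additive : nmod_morphism mx_ext.
Proof.
split; last exact: mx_extD.
by rewrite -(scale0r 0) mx_extZ rmorph0 scale0r.
Qed.

Lemma mx_ext_comp f g : mx_ext (f \o g)%VF = mx_ext g * mx_ext f.
Proof.
have := mulmx_block (0 : 'M[C]_1) (0 : 'M_(1, n)) (0 : 'M_(n, 1))
  (map_mx iota (mxof b b g)) (0 : 'M_1) (0 : 'M_(1, n)) 0
  (map_mx iota (mxof b b f)).
rewrite !mulmx0 !mul0mx !addr0 add0r -map_mxM -(mxof_comp _ _ (vbasisP _)).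
exact: esym.
Qed.

Lemma mx_ext_eq0 f : mx_ext f = 0 -> f = 0.
Proof.
move/(congr1 (fun M : 'M_(1 + n, 1 + n) => drsubmx M)).
rewrite block_mxKdr (_ : drsubmx _ = 0); last first.
  by apply/matrixP => i j; rewrite !mxE.
by move/eqP; rewrite map_mx_eq0 mxof_eq0 ?vbasisP // => /eqP.
Qed.

HB.instance Definition _ :=
  GRing.isNmodMorphism.Build 'End(h) 'M[C]_n.+1 mx_ext mx_ext_additive.

(** The adjoint algebra with scalars extended to C. *)
Definition adC : {vspace 'M[C]_n.+1} := <<[seq mx_ext (ad x) | x <- b]>>.

Lemma mem_adC x : mx_ext (ad x) \in adC.
Proof.
rewrite (coord_vbasis (memvf x)).
have -> : ad (\sum_i coord b i x *: b`_i) = \sum_i coord b i x *: ad b`_i.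
  apply/lfunP => y; rewrite adE sum_lfunE linear_sumlz.
  by apply: eq_bigr => i _; rewrite linearZl_LR scale_lfunE adE.
rewrite raddf_sum memv_suml //= => i _; rewrite mx_extZ memvZ // memv_span //.
by apply/mapP; exists b`_i; rewrite // mem_nth // size_tuple.
Qed.

Lemma adl_mx_ext f g :
  adl (mx_ext f) (mx_ext g) = mx_ext ((g \o f) - (f \o g))%VF.
Proof. by rewrite raddfB /= !mx_ext_comp. Qed.

Lemma adl_adC : {in adC &, forall u v, adl u v \in adC}.
Proof.
have sub (u : 'M_n.+1) : (forall x, adl u (mx_ext (ad x)) \in adC) ->
    {in adC, forall v, adl u v \in adC}.
  move=> uad v vad; have : (adC <= linfun (adl u) @^-1: adC)%VS.
    by apply/span_subvP => _ /mapP[x _ ->]; rewrite -memv_preim lfunE /=.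
  by move/subvP/(_ v vad); rewrite -memv_preim lfunE /=.
move=> u v uad; apply: (sub u) v => x; rewrite adlC memvN.
apply: (sub _ _ u uad) => y.
by rewrite adl_mx_ext -ad_lieb mem_adC.
Qed.

Variable d : 'End(h).
Hypotheses (d_der : derivation d) (d_ns : nonsingular d).

Lemma adl_derivation x : adl (mx_ext d) (mx_ext (ad x)) = - mx_ext (ad (d x)).
Proof. by rewrite adl_mx_ext (ad_derivation _ d_der) -opprB raddfN. Qed.

(** Surjectivity, unlike injectivity, can be checked on a spanning set, where it follows from the
    invertibility of d. A dimension count then gives injectivity on [adC]. *)
Lemma adl_d_adC : (linfun (adl (mx_ext d)) @: adC = adC)%VS.
Proof.
apply/eqP; rewrite eqEsubv; apply/andP; split.
  rewrite limg_span; apply/span_subvP => _ /mapP[_ /mapP[x _ ->] ->].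
  by rewrite lfunE /= adl_derivation memvN mem_adC.
apply/span_subvP => _ /mapP[x _ ->].
rewrite -[x](lker0_lfunVK d_ns) -[mx_ext _]opprK -adl_derivation -linearN /=.
by rewrite -[adl _ _]lfunE memv_img ?memvN ?mem_adC.
Qed.

Lemma adC_nilpotent : exists N, (adC ^+ N = 0)%VS.
Proof.
apply: (nilpotent_of_injective_adl (D := mx_ext d)) => //.
- exact: adl_adC.
- by move=> u uad; rewrite -[adl _ _]lfunE -adl_d_adC memv_img.
move=> u uad du0; apply/eqP; rewrite -memv0.
suff <- : (adC :&: lker (linfun (adl (mx_ext d))))%VS = 0%VS.
  by rewrite memv_cap uad memv_ker lfunE /= du0.
apply/eqP; rewrite -dimv_eq0 -(eqn_add2r (\dim adC)) -{2}adl_d_adC.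
by rewrite limg_ker_dim.
Qed.

Definition ad_word (w : seq h) : 'End(h) :=
  foldr (fun x f => (f \o ad x)%VF) \1%VF w.

(** The factor [fullv] is there for the empty word: because of its zero corner, [mx_ext] of the
    identity is not the identity matrix. *)
Lemma ad_word_adC w : mx_ext (ad_word w) \in (adC ^+ size w * fullv)%VS.
Proof.
elim: w => [|x w IHw] /=; first by rewrite expv0 prod1v memvf.
by rewrite mx_ext_comp expvSl -prodvA memv_mul ?mem_adC.
Qed.

Theorem nonsingular_derivation_nilpotent : lie_nilpotent h.
Proof.
have [N adN] := adC_nilpotent; exists N.
(* Words of length N - k kill the k-th term of the lower central series: k = 0 is the vanishing of
   words of length N, k = N is the claim. A bracket with x becomes a letter of the word. *)
suff lcN k w y :
    (k + size w)%N = N -> y \in lower_central h k -> ad_word w y = 0.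
  apply/eqP; rewrite -subv0; apply/subvP => y /(lcN N [::]).
  by rewrite addn0 id_lfunE memv0 => ->.
elim: k w y => [|k IHk] w y.
  rewrite add0n => wN _; have := ad_word_adC w.
  by rewrite wN adN prod0v memv0 => /eqP/mx_ext_eq0 ->; rewrite zero_lfunE.
move=> kwN ylc; apply/eqP; rewrite -memv_ker; move: y ylc.
apply/subvP/lievP => x z _ zlc; rewrite memv_ker -adE -comp_lfunE.
by apply/eqP/(IHk (x :: w)); rewrite // addnS.
Qed.

End NonsingularDerivation.

(** * Symplectic structures *)

Section Forms.
Variables (K : fieldType) (h : lieAlgType K).
Implicit Types (x y z : h).

Section Flat.
Variables (eps : bool) (f : {hermitian h for eps & idfun}).

Lemma nondegenerateP :
  nondegenerate f <-> (forall x, (forall y, f x y = 0) -> x = 0).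
Proof.
split=> [/eqP f0 x fx0 | f0].
  by apply/eqP; rewrite -memv0 -f0; apply/mem_orthovP => y _.
rewrite /nondegenerate -subv0; apply/subvP => x /mem_orthovP fx.
by rewrite memv0 (f0 x) // => y; rewrite fx ?memvf.
Qed.

(** Keeping [eps] arbitrary lets one construction serve metrics and 2-forms. *)
Definition flat_fun x : 'Hom(h, K^o) := linfun (f x : h -> K^o).

Fact flat_is_linear : linear flat_fun.
Proof.
move=> a x y; apply/lfunP => z.
by rewrite add_lfunE scale_lfunE !lfunE /= linearPl.
Qed.

HB.instance Definition _ :=
  GRing.isLinear.Build K h 'Hom(h, K^o) _ flat_fun flat_is_linear.

Definition flat : 'Hom(h, 'Hom(h, K^o)) := linfun flat_fun.

Lemma flatE x y : flat x y = f x y. Proof. by rewrite !lfunE. Qed.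

Hypothesis f_nd : nondegenerate f.

Lemma lker_flat : lker flat == 0%VS.
Proof.
rewrite -subv0; apply/subvP => x; rewrite memv_ker memv0 => /eqP fx0.
by apply/eqP/(nondegenerateP.1 f_nd) => y; rewrite -flatE fx0 zero_lfunE.
Qed.

Lemma flatK : cancel flat flat^-1%VF.
Proof. exact: lker0_lfunK lker_flat. Qed.

Lemma flatVK : cancel flat^-1%VF flat.
Proof.
move=> u; apply: limg_lfunVK; suff -> : limg flat = fullv by apply: memvf.
apply/eqP; rewrite eqEdim subvf limg_dim_eq; last first.
  by rewrite (eqP lker_flat) capv0.
by rewrite !dimvf /dim /= muln1.
Qed.

End Flat.

Lemma skew_form_of (A : 'Hom(h, 'Hom(h, K^o))) :
    (forall x y, A x y = - A y x) ->
  exists w : {skew_symmetric h}, forall x y, w x y = A x y.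
Proof.
move=> A_skew; pose w x y : K := A x y.
have wl y : linear_for *%R (w^~ y).
  by move=> a x x'; rewrite /w linearP add_lfunE scale_lfunE.
have wr x : linear_for (idfun \; *%R) (w x).
  by move=> a y y'; rewrite /w linearP.
have wh x y : w x y = (-1) ^+ true * idfun (w y x) by rewrite mulN1r -A_skew.
pose wb := bilinear_isBilinear.Build K h h K _ _ w (wl, wr).
pose wm := isHermitianSesquilinear.Build K h true idfun w wh.
by exists (HB.pack_for {skew_symmetric h} w wb wm).
Qed.

Lemma hermN (w : {skew_symmetric h}) x y : w x y = - w y x.
Proof. by rewrite hermC mulN1r. Qed.

Lemma hermS (B : {symmetric h}) x y : B x y = B y x.
Proof. by rewrite hermC mul1r. Qed.

(** In this form, closedness says that [flat w] is a 1-cocycle with values in the coadjoint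
    representation. *)
Lemma closed_formP (w : {skew_symmetric h}) :
  closed_form w <-> (forall x y z, w ⁅x, y⁆ z = w x ⁅y, z⁆ - w y ⁅x, z⁆).
Proof.
have eq x y z : w ⁅x, y⁆ z + w ⁅y, z⁆ x + w ⁅z, x⁆ y =
    w ⁅x, y⁆ z - (w x ⁅y, z⁆ - w y ⁅x, z⁆).
  rewrite (hermN w ⁅y, z⁆) (hermN w ⁅z, x⁆) (liebC z x) linearNr opprK.
  by rewrite opprB -addrA [- _ + _]addrC.
split=> [cl x y z|cl x y z]; last by rewrite eq cl subrr.
by apply/eqP; rewrite -subr_eq0 -eq cl.
Qed.

Lemma ad_invariantE (B : {symmetric h}) x y z :
  ad_invariant B -> B ⁅x, y⁆ z = B x ⁅y, z⁆.
Proof.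
move=> B_inv; rewrite liebC linearNl /=; apply/eqP.
by rewrite eq_sym -addr_eq0 addrC B_inv.
Qed.

(** An ad-invariant B identifies the adjoint with the coadjoint representation, turning the cocycle
    [flat w] into a derivation. *)
Lemma symplectic_to_derivation (B : {symmetric h}) (w : {skew_symmetric h}) :
    metric B -> ad_invariant B -> symplectic_structure w ->
  exists d : 'End(h), [/\ derivation d, nonsingular d & skew_for B d].
Proof.
move=> B_nd B_inv [w_nd w_cl].
pose d : 'End(h) := ((flat B)^-1 \o flat w)%VF.
have dE x y : B (d x) y = w x y.
  by rewrite -(flatE B) comp_lfunE flatVK ?flatE.
exists d; split=> [x y||x y].
- apply/eqP; rewrite -subr_eq0; apply/eqP.
  apply: ((nondegenerateP B).1 B_nd) => // z.
  rewrite linearBl linearDl /= dE ((closed_formP w).1 w_cl) (liebC x (d y)).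
  by rewrite linearNl /= !ad_invariantE // !dE subrr.
- rewrite /nonsingular -subv0; apply/subvP => x.
  rewrite memv_ker memv0 => /eqP dx0; apply/eqP.
  by apply: ((nondegenerateP w).1 w_nd) => // y; rewrite -dE dx0 linear0l.
- by rewrite dE hermN -dE hermS.
Qed.

Lemma derivation_to_symplectic (B : {symmetric h}) (d : 'End(h)) :
    metric B -> ad_invariant B ->
    derivation d -> nonsingular d -> skew_for B d ->
  exists w : {skew_symmetric h}, symplectic_structure w.
Proof.
move=> B_nd B_inv d_der d_ns d_skew.
have [|w wE] := @skew_form_of (flat B \o d)%VF.
  by move=> x y; rewrite !comp_lfunE !flatE d_skew hermS.
have {}wE x y : w x y = B (d x) y by rewrite wE comp_lfunE flatE.
exists w; split.
  apply/nondegenerateP => x wx0; apply: (lker0P d_ns); rewrite linear0.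
  by apply: ((nondegenerateP B).1 B_nd) => // y; rewrite -wE.
apply/closed_formP => x y z; rewrite !wE d_der linearDl /=.
by rewrite ad_invariantE // (liebC x) linearNl /= ad_invariantE.
Qed.

(** * Brackets in the cotangent algebra and generalized complex structures *)

Lemma coadBE x y z (f g : 'Hom(h, K^o)) :
  (coad x f - coad y g) z = g ⁅y, z⁆ - f ⁅x, z⁆.
Proof. by rewrite add_lfunE (opp_lfunE (coad y g)) !coadE opprK addrC. Qed.

Lemma coadN x (f : 'Hom(h, K^o)) : coad (- x) f = - coad x f.
Proof.
by apply/lfunP => z; rewrite (opp_lfunE (coad x f)) !coadE linearNl linearN.
Qed.

Lemma coad0l (f : 'Hom(h, K^o)) : coad 0 f = 0.
Proof.
by apply/lfunP => z; rewrite coadE linear0l linear0 oppr0 zero_lfunE.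
Qed.

Lemma coad0r x : coad x (0 : 'Hom(h, K^o)) = 0.
Proof. by apply/lfunP => z; rewrite coadE !zero_lfunE oppr0. Qed.

Lemma lieb_inl x y : ⁅cot_inl x, cot_inl y⁆ = cot_inl ⁅x, y⁆.
Proof. by congr pair; rewrite /= !coad0r subrr. Qed.

Lemma lieb_inl_inr x (f : 'Hom(h, K^o)) :
  ⁅cot_inl x, cot_inr f⁆ = cot_inr (coad x f).
Proof. by congr pair; rewrite /= ?linear0 // coad0r subr0. Qed.

Lemma lieb_inr (f g : 'Hom(h, K^o)) : ⁅cot_inr f, cot_inr g⁆ = 0.
Proof. by congr pair; rewrite /= ?linear0 // !coad0l subrr. Qed.

Lemma gcs_to_symplectic (J : 'End(cotangent h)) :
    generalized_complex_structure J -> symplectic_type J ->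
  exists w : {skew_symmetric h}, symplectic_structure w.
Proof.
move=> [[J2 J_int] J_herm] J_type.
pose a x : 'Hom(h, K^o) := (J (cot_inl x)).2.
have a_lin : linear a by move=> c x y; rewrite /a !linearP.
pose aL := GRing.isLinear.Build K h _ _ a a_lin.
pose A := linfun (HB.pack a aL : {linear h -> 'Hom(h, K^o)}).
have JE x : J (cot_inl x) = cot_inr (A x).
  have /cot_fiberP J1 : J (cot_inl x) \in cot_fiber h.
    by rewrite -J_type memv_img //; apply/cot_baseP.
  by rewrite lfunE /= /a; case: (J _) J1 => u f /= ->.
have JE' x : J (cot_inr (A x)) = - cot_inl x by rewrite -JE J2.
have [|w wE] := @skew_form_of A.
  (* Skewness is the Hermitian condition for (x, 0) and J (y, 0). *)
  move=> x y; have := J_herm (cot_inl x) (cot_inr (A y)).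
  rewrite JE JE' /cot_metric /= linearN /= zero_lfunE addr0 oppr0 zero_lfunE.
  by rewrite add0r => <-; rewrite opprK.
exists w; split.
  apply/nondegenerateP => x wx0.
  have A0 : A x = 0 by apply/lfunP => y; rewrite -wE wx0 zero_lfunE.
  have := J2 (cot_inl x); rewrite JE A0 linear0.
  by move=> /(congr1 (fun u => - u.1)) /=; rewrite opprK oppr0.
apply/closed_formP => x y z; rewrite !wE.
(* Since h^* is abelian, J applied to the integrability condition on h leaves J [x, y] = [J x, y] +
   [x, J y], whose second component is the cocycle identity. *)
have /(congr1 (fun u => J u)) := J_int (cot_inl x) (cot_inl y).
rewrite linear0 !linearB /= !J2 !JE lieb_inr linear0 sub0r lieb_inl JE.
rewrite (liebC (cot_inr _)) !lieb_inl_inr !opprK.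
move=> /(congr1 snd) /= /eqP.
rewrite -addrA addrC subr_eq0 [- _ + _]addrC => /eqP <-.
exact: coadBE.
Qed.

Lemma symplectic_to_gcs (w : {skew_symmetric h}) :
    symplectic_structure w ->
  exists J : 'End(cotangent h),
    generalized_complex_structure J /\ symplectic_type J.
Proof.
move=> [w_nd /closed_formP w_cl].
pose A := flat w; pose A' := (flat w)^-1%VF.
have AK : cancel A A' by apply: flatK.
have A'K : cancel A' A by apply: flatVK.
have A_skew x y : A x y = - A y x by rewrite !flatE hermN.
have A_cl x y : A ⁅x, y⁆ = coad x (A y) - coad y (A x).
  by apply/lfunP => z; rewrite coadBE !flatE w_cl.
pose j (u : cotangent h) : cotangent h := (- A' u.2, A u.1).
have j_lin : linear j.
  move=> a u v; congr pair; rewrite /= ?linearP //= opprD scalerN.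
pose jL := GRing.isLinear.Build K (cotangent h) (cotangent h) _ j j_lin.
pose J := linfun (HB.pack j jL : {linear cotangent h -> cotangent h}).
have JE x f : J (x, f) = (- A' f, A x) by rewrite lfunE.
exists J; split; [split; [split|]|].
- by case=> x f; rewrite !JE linearN /= AK A'K.
(* Writing f = A p and g = A q expresses both components through coadjoint terms that [A_cl]
   relates. *)
- case=> x f [y g]; rewrite -[f]A'K -[g]A'K; move: (A' f) (A' g) => p q.
  rewrite !JE !AK !cot_bracketE /=.
  have cN := coadN; move: (@coad K h) cN A_cl => c cN A_cl.
  rewrite !cN !linearNl !linearNr /= !opprK; congr pair => /=.
    rewrite !opprK -addrA -linearD /=.
    have -> : - c p (A q) - c y (A x) + (c x (A y) + c q (A p)) =
        A (⁅x, y⁆ - ⁅p, q⁆).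
      by rewrite linearB /= !A_cl opprB addrC [- _ - _]addrC addrACA.
    by rewrite AK addrA subrK subrr.
  rewrite !linearN /= !A_cl !opprK !opprB.
  move: (c p _) (c q _) (c x _) (c y _) => r1 r2 r3 r4.
  apply/lfunP => z; rewrite !(add_lfunE, opp_lfunE, zero_lfunE) /=; ring.
- case=> x f [y g]; rewrite !JE /cot_metric /= !linearN /=.
  by rewrite -{2}[f]A'K -{2}[g]A'K ![A _ (A' _)]A_skew !opprK addrC.
apply/vspaceP => -[x f]; apply/memv_imgP/cot_fiberP => /=.
  by case=> -[y g] /cot_baseP /= -> []; rewrite JE linear0 oppr0 => -[->].
move=> ->; exists (A' f, 0); first exact/cot_baseP.
by rewrite JE linear0 oppr0 A'K.
Qed.

End Forms.

(** * The equivalences and nilpotency *)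

Theorem corollary5p6 (R : realType) (h : lieAlgType R)
    (even_h : ~~ odd (\dim {:h})) (B : {symmetric h})
    (B_metric : metric B) (B_inv : ad_invariant B) :
  let gcs_symplectic_type := exists J : 'End(cotangent h),
    generalized_complex_structure J /\ symplectic_type J in
  let symplectic := exists w : {skew_symmetric h}, symplectic_structure w in
  let nonsingular_skew_derivation := exists d : 'End(h),
    [/\ derivation d, nonsingular d & skew_for B d] in
  [/\ gcs_symplectic_type <-> symplectic,
      symplectic <-> nonsingular_skew_derivation &
      [\/ gcs_symplectic_type, symplectic | nonsingular_skew_derivation] ->
      lie_nilpotent h].
Proof.
move=> gcs sympl nsd.
have i_ii : gcs -> sympl by case=> J [J_gcs /(gcs_to_symplectic J_gcs)].
have ii_i : sympl -> gcs by case=> w /symplectic_to_gcs.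
have ii_iii : sympl -> nsd by case=> w; apply: symplectic_to_derivation.
have iii_ii : nsd -> sympl.
  by case=> d [d_der d_ns d_skew]; apply: derivation_to_symplectic d_skew.
have nil : nsd -> lie_nilpotent h.
  case=> d [d_der d_ns _].
  (* Scalars are extended from R to its algebraic closure [R[i]], where eigenvalues exist. *)
  apply: (@nonsingular_derivation_nilpotent _ R[i] (real_complex R)) d_der d_ns.
  exact: pchar_num.
by split=> //; case=> [/i_ii/ii_iii|/ii_iii|] /nil.
Qed.
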